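(* The linear map $\zeta_{\mathrm{FI}}:\mathcal{W}_{\{x,y\}}\to\mathcal{A}_{\{x,y\}}$ defined by $\zeta_{\mathrm{FI}}(\emptyset)=\emptyset\otimes\emptyset\times G$ and $$\zeta_{\mathrm{FI}}(\omega_1\cdots\omega_k)=\int_{0<t_1<\dots<t_k<1}\Big(\prod_{i=1}^k g_{\omega_i}\Big)\prod_{i=1}^k\mathrm{d}t_i$$ is a morphism of (augmented) dendriform algebras.
   Context: All vector spaces are over a common ground field $\mathbb{K}$. **Dendriform algebras.** A dendriform algebra is a vector space $A$ with bilinear operations $\prec,\succ$ such that, with $x\star y:=x\prec y+x\succ y$, for all $x,y,z\in A$: $(x\prec y)\prec z=x\prec(y\star z)$; $(x\succ y)\prec z=x\succ(y\prec z)$; $(x\star y)\succ z=x\succ(y\succ z)$. The augmented dendriform algebra is $\overline A=A\oplus\mathbb{K}1$ with $1\prec a=0=a\succ1$, $a\prec1=a=1\succ a$ for $a\in A$ (and $1\star1=1$). A morphism of augmented dendriform algebras is a linear map sending $1$ to $1$, $A$ to $B$, and preserving $\prec,\succ$ on $A$. **Words.** $\mathcal{W}_{\{x,y\}}$ is the vector space with basis the finite words on $\{x,y\}$, $\emptyset$ the empty word. The shuffle product $\star_{s}$ is defined by $u\star_s\emptyset=\emptyset\star_s u=u$ and, for nonempty $u=u_1\cdots u_n$, $v=v_1\cdots v_k$, $u\star_s v=u\prec v+u\succ v$ with $u\prec v=u_1(u_2\cdots u_n\star_s v)$ and $u\succ v=v_1(u\star_s v_2\cdots v_k)$. This makes $\mathcal{W}_{\{x,y\}}$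 an augmented dendriform algebra with unit $\emptyset$. **Formal integrals.** For $n\in\mathbb{N}$, let $\mathrm{B}_{\mathrm{int}}(\mathbb{R}^n)$ be the set of Borel subsets of $\mathbb{R}^n$ modulo Lebesgue-negligible Borel sets, $\mathbb{K}\mathrm{B}_{\mathrm{int}}(\mathbb{R}^n)$ the vector space with this basis, an algebra for $\cup$, and $\mathfrak{B}(\mathbb{R}^n)$ its quotient by the ideal generated by the elements $A\cup B-A-B+A\cap B$. Fix $G$ with $G(x)=g_x:t\mapsto 1/t$ and $G(y)=g_y:t\mapsto1/(1-t)$ on $(0,1)$. A formal integral is a pair $(B\otimes w,G)$, with first component in $\langle\mathfrak{B}(\mathbb{R}^{\ell(w)})\otimes w\mid w\text{ a word on }\{x,y\}\rangle$ ($\ell$ = length), also written $B\otimes w\times G$ or $\int_B\big(\prod_{i=1}^k g_{w_i}\big)\mathrm{d}t_1\cdots\mathrm{d}t_k$; it is purely formal, and vector space operations are those of the first component. $\mathcal{A}_{\{x,y\}}$ is the span of all $\int_{0<t_1<\dots<t_r<1}\big(\prod_{i=1}^r g_{\omega_i}\big)\prod_{i=1}^r\mathrm{d}t_i$, $r\ge0$, $\omega_i\in\{x,y\}$; the element for $r=0$, $\emptyset\otimes\emptyset\times G$, is the unit. **Operations on $\mathcal{A}_{\{x,y\}}$.** For $k,l\ge1$, $\mathrm{Sh}(k,l)$ is the set of permutations $\sigma\in S_{k+l}$ with $\sigma(1)<\dots<\sigma(k)$ and $\sigma(k+1)<\dots<\sigma(k+l)$. For $\alpha=\int_{0<t_1<\dots<t_k<1}\prod_{i=1}^k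 g_{\omega_i}\mathrm{d}t_i$ and $\beta=\int_{0<t_{k+1}<\dots<t_{k+l}<1}\prod_{i=k+1}^{k+l}g_{\omega_i}\mathrm{d}t_i$ with $k,l\geq 1$, $\alpha\prec\beta$ (resp. $\alpha\succ\beta$) is $\sum_\sigma\int_{0<t_1<\dots<t_{k+l}<1}\prod_{i=1}^{k+l}g_{\omega_{\sigma^{-1}(i)}}\mathrm{d}t_i$ over $\sigma\in\mathrm{Sh}(k,l)$ with $\sigma^{-1}(1)=1$ (resp. $\sigma^{-1}(1)=k+1$). With these, $\mathcal{A}_{\{x,y\}}$ is an augmented dendriform algebra. *)

(* Defs.v *)
From HB Require Import structures.
From mathcomp Require Import all_boot all_order all_fingroup all_algebra.
From mathcomp Require Import generic_quotient finmap.
From mathcomp Require Import all_classical all_reals.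
From mathcomp Require Import ereal topology normedtype.
From mathcomp Require Import measurable_structure esum.
(* The notations of monalg clash with those of the analysis library. *)
From mathcomp.multinomials Require Import -(notations) monalg.

Set Implicit Arguments.
Unset Strict Implicit.
Unset Printing Implicit Defensive.

Import Order.TTheory GRing.Theory Num.Theory.
Import numFieldNormedType.Exports.

Local Open Scope quotient_scope.
Local Open Scope classical_set_scope.
Local Open Scope ring_scope.

(* [malg I K] is the free K-vector space with basis I: [mkmalgU i 1] is the
   basis vector i and [mcoeff i c] is the coefficient of c along i. *)

Section LinearExtension.
Variables (K : fieldType) (I : choiceType) (V : lmodType K).

Definition lin_ext (f : I -> V) (c : malg I K) : V :=
  \sum_(k <- msupp c) mcoeff k c *: f k.

Lemma lin_extEw (f : I -> V) (d : {fset I}) c : (msupp c `<=` d)%fset ->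
  lin_ext f c = \sum_(k <- d) mcoeff k c *: f k.
Proof.
move=> le; rewrite /lin_ext (big_fset_incl _ le) => //= x xd /mcoeff_outdom ->.
by rewrite scale0r.
Qed.

Fact lin_ext_linear f : linear (lin_ext f).
Proof.
move=> a c d.
have lec : (msupp c `<=` msupp c `|` msupp d `|` msupp (a *: c + d))%fset.
  by rewrite -fsetUA fsubsetUl.
have led : (msupp d `<=` msupp c `|` msupp d `|` msupp (a *: c + d))%fset.
  by rewrite fsetUAC fsubsetUr.
rewrite (lin_extEw _ (fsubsetUr (msupp c `|` msupp d)%fset _)).
rewrite (lin_extEw _ lec) (lin_extEw _ led) scaler_sumr -big_split /=.
by apply: eq_bigr => k _; rewrite mcoeffD mcoeffZ scalerDl scalerA.
Qed.

HB.instance Definition _ f :=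
  GRing.isLinear.Build K (malg I K) V _ (lin_ext f) (lin_ext_linear f).

Lemma lin_extUZ f k x : lin_ext f (mkmalgU k x) = x *: f k.
Proof. by rewrite (lin_extEw _ msuppU_le) big_seq_fset1 mcoeffUU. Qed.

Lemma lin_extU f k : lin_ext f (mkmalgU k 1) = f k.
Proof. by rewrite lin_extUZ scale1r. Qed.

Definition lin_span (f : I -> V) (P : pred I) : pred V :=
  fun v => `[< exists2 c : malg I K,
                 (forall k, k \in msupp c -> P k) & v = lin_ext f c >].

Lemma lin_span_submod f P : subsemimod_closed (lin_span f P).
Proof.
split; first split.
- by apply/asboolP; exists 0 => [k|]; rewrite ?msupp0// raddf0.
- move=> _ _ /asboolP[c Pc ->] /asboolP[d Pd ->]; apply/asboolP.
  exists (c + d); last by rewrite raddfD.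
  move=> k /(fsubsetP (msuppD_le _ _)); rewrite in_fsetU.
  by case/orP => [/Pc|/Pd].
- move=> a _ /asboolP[c Pc ->]; apply/asboolP; exists (a *: c).
    by move=> k /(fsubsetP (msuppZ_le _ _)) /Pc.
  by rewrite linearZ.
Qed.

HB.instance Definition _ f P :=
  GRing.isSubmodClosed.Build K V (lin_span f P) (lin_span_submod f P).

Lemma mem_lin_span f (P : pred I) k : P k -> f k \in lin_span f P.
Proof.
move=> Pk; apply/asboolP; exists (mkmalgU k 1); last by rewrite lin_extU.
by move=> l /(fsubsetP msuppU_le); rewrite in_fset1 => /eqP ->.
Qed.

End LinearExtension.

Section Weight.
Variables (K : fieldType) (M : monomType).

Definition weight (c : malg M K) : K^o := lin_ext (fun=> 1 : K^o) c.
HB.instance Definition _ :=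
  GRing.isLinear.Build K (malg M K) K^o _ weight (lin_ext_linear _).

Lemma weightU (m : M) x : weight (mkmalgU m x) = x.
Proof. by rewrite /weight lin_extUZ /GRing.scale/= mulr1. Qed.

Lemma weight_mulU (c : malg M K) m : weight (c * mkmalgU m 1) = weight c.
Proof.
rewrite [c in LHS]monalgE [c in RHS]monalgE mulr_suml !raddf_sum.
apply: eq_bigr => k _; rewrite malgM_def fgmulUU /=.
by rewrite !weightU mulr1.
Qed.

Lemma weight_alternating (c : malg M K) m1 m2 m3 m4 :
  weight (c * (mkmalgU m1 1 - mkmalgU m2 1 - mkmalgU m3 1 + mkmalgU m4 1)) = 0.
Proof.
rewrite mulrDr 2!mulrBr linearD 2!linearB /= 4!weight_mulU.
by rewrite subrr sub0r addNr.
Qed.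

End Weight.

Definition bilin_ext (K : fieldType) (I : choiceType) (V : lmodType K)
    (f : I -> I -> V) (c d : malg I K) : V :=
  lin_ext (fun u => lin_ext (f u) d) c.

(* Data of an augmented dendriform algebra A (+) K1, with [aug_part] the
   subspace A. The values of [aug_prec] and [aug_succ] at (1, 1) carry no meaning. *)
Record aug_data (K : fieldType) := AugData {
  aug_space :> lmodType K;
  aug_one : aug_space;
  aug_part : pred aug_space;
  aug_prec : aug_space -> aug_space -> aug_space;
  aug_succ : aug_space -> aug_space -> aug_space;
  aug_star : aug_space -> aug_space -> aug_space }.

Definition bilinear_on (K : fieldType) (V : lmodType K) (P : pred V)
    (op : V -> V -> V) : Prop :=
  (forall (k : K) (a a' b : V), P a -> P a' -> P b ->
     op (k *: a + a') b = k *: op a b + op a' b) /\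
  (forall (k : K) (a b b' : V), P a -> P b -> P b' ->
     op a (k *: b + b') = k *: op a b + op a b').

Record dendriform_on (K : fieldType) (V : lmodType K) (P : pred V)
    (prec succ : V -> V -> V) : Prop := {
  dendriform_subspace : submod_closed P;
  dendriform_prec_closed : forall a b, P a -> P b -> P (prec a b);
  dendriform_succ_closed : forall a b, P a -> P b -> P (succ a b);
  dendriform_prec_bilinear : bilinear_on P prec;
  dendriform_succ_bilinear : bilinear_on P succ;
  dendriform_prec_prec : forall a b c, P a -> P b -> P c ->
    prec (prec a b) c = prec a (prec b c + succ b c);
  dendriform_succ_prec : forall a b c, P a -> P b -> P c ->
    prec (succ a b) c = succ a (prec b c);
  dendriform_star_succ : forall a b c, P a -> P b -> P c ->
    succ (prec a b + succ a b) c = succ a (succ b c) }.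

Record is_augmented_dendriform (K : fieldType) (D : aug_data K) : Prop := {
  augmented_dendriform :
    dendriform_on (@aug_part K D) (@aug_prec K D) (@aug_succ K D);
  (* the direct sum decomposition A (+) K1 *)
  augmented_direct : forall z : D,
    exists! p : K * D, aug_part p.2 /\ z = p.2 + p.1 *: aug_one D;
  augmented_one_prec : forall a : D, aug_part a -> aug_prec (aug_one D) a = 0;
  augmented_succ_one : forall a : D, aug_part a -> aug_succ a (aug_one D) = 0;
  augmented_prec_one : forall a : D, aug_part a -> aug_prec a (aug_one D) = a;
  augmented_one_succ : forall a : D, aug_part a -> aug_succ (aug_one D) a = a;
  augmented_star : forall a b : D, aug_part a -> aug_part b ->
    aug_star a b = aug_prec a b + aug_succ a b;
  augmented_one_star : forall a : D, aug_star (aug_one D) a = a;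
  augmented_star_one : forall a : D, aug_star a (aug_one D) = a;
  augmented_star_bilinear : bilinear_on predT (@aug_star K D) }.

Record is_augmented_morphism (K : fieldType) (D E : aug_data K)
    (f : {linear D -> E}) : Prop := {
  morphism_source : is_augmented_dendriform D;
  morphism_target : is_augmented_dendriform E;
  morphism_one : f (aug_one D) = aug_one E;
  morphism_part : forall a : D, aug_part a -> aug_part (f a);
  morphism_prec : forall a b : D, aug_part a -> aug_part b ->
    f (aug_prec a b) = aug_prec (f a) (f b);
  morphism_succ : forall a b : D, aug_part a -> aug_part b ->
    f (aug_succ a b) = aug_succ (f a) (f b) }.

Variant letter := lx | ly.

Definition bool_of_letter (a : letter) : bool :=
  if a is lx then false else true.
Definition letter_of_bool (b : bool) : letter := if b then ly else lx.
Lemma bool_of_letterK : cancel bool_of_letter letter_of_bool.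
Proof. by case. Qed.
HB.instance Definition _ := Countable.copy letter (can_type bool_of_letterK).

Notation word := (seq letter).

Section Shuffle.
Variable K : fieldType.

Let wordv (w : word) : malg word K := mkmalgU w 1.

Definition cons_letter (a : letter) : malg word K -> malg word K :=
  lin_ext (fun w => wordv (a :: w)).

Fixpoint word_star (u : word) {struct u} : word -> malg word K :=
  fix word_star_u (v : word) : malg word K :=
    match u, v with
    | [::], _ => wordv v
    | _, [::] => wordv u
    | a :: u', b :: v' =>
        cons_letter a (word_star u' v) + cons_letter b (word_star_u v')
    end.

Definition word_prec (u v : word) : malg word K :=
  match u, v with
  | [::], _ => 0
  | _, [::] => wordv u
  | a :: u', _ :: _ => cons_letter a (word_star u' v)
  end.

Definition word_succ (u v : word) : malg word K :=
  match u, v with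
  | _, [::] => 0
  | [::], _ => wordv v
  | _ :: _, b :: v' => cons_letter b (word_star u v')
  end.

Definition shuffle_words : aug_data K := {|
  aug_space := malg word K;
  aug_one := wordv [::];
  aug_part := lin_span wordv (fun w => w != [::]);
  aug_prec := bilin_ext word_prec;
  aug_succ := bilin_ext word_succ;
  aug_star := bilin_ext word_star |}.

End Shuffle.

Section BorelMod.
Variables (R : realType) (n : nat).

Definition box (p : 'rV[R]_n * 'rV[R]_n) : set 'rV[R]_n :=
  [set t | forall i, p.1 0 i <= t 0 i <= p.2 0 i].

Definition box_volume (p : 'rV[R]_n * 'rV[R]_n) : R :=
  \prod_(i < n) (p.2 0 i - p.1 0 i).

(* The Lebesgue outer measure of A is 0. Covers are countable sets of boxes,
   possibly empty, so that in dimension 0 the empty set is negligible although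
   every box has volume 1. *)
Definition lebesgue_negligible (A : set 'rV[R]_n) : Prop :=
  forall e : R, 0 < e ->
  exists C : set ('rV[R]_n * 'rV[R]_n),
    [/\ countable C,
        (forall p, C p -> forall i, p.1 0 i <= p.2 0 i),
        A `<=` \bigcup_(p in C) box p &
        (\esum_(p in C) (box_volume p)%:E <= e%:E)%E].

Lemma lebesgue_negligible0 : lebesgue_negligible set0.
Proof.
move=> e e0; exists set0; split => //.
by rewrite esum_set0 lee_fin ltW.
Qed.

Lemma lebesgue_negligibleS A B :
  A `<=` B -> lebesgue_negligible B -> lebesgue_negligible A.
Proof.
move=> AB nB e /nB[C [cC oC BC vC]]; exists C; split => //.
exact: subset_trans BC.
Qed.

Lemma lebesgue_negligibleU A B : lebesgue_negligible A ->
  lebesgue_negligible B -> lebesgue_negligible (A `|` B).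
Proof.
move=> nA nB e e0; have e20 : 0 < e / 2 by rewrite divr_gt0.
have [C [cC oC AC vC]] := nA _ e20; have [D [cD oD BD vD]] := nB _ e20.
have vol0 p : (C `|` D) p -> (0 <= (box_volume p)%:E)%E.
  move=> CDp; rewrite lee_fin prodr_ge0// => i _; rewrite subr_ge0.
  by case: CDp => [/oC|/oD]; exact.
exists (C `|` D); split.
- by rewrite -bigcup2E; apply: bigcup_countable => // -[|[|]] //= _.
- by move=> p [/oC|/oD].
- move=> t [/AC[p Cp pt]|/BD[p Dp pt]]; exists p => //; [by left|by right].
- rewrite (esumID C)//= (splitr e) EFinD; apply: leeD.
    suff -> : (C `|` D) `&` C = C by [].
    by rewrite setIC; apply/setIidl => p; left.
  apply: le_trans vD.
  rewrite [leLHS]esum_mkcond [leRHS]esum_mkcond; apply: le_esum => p _.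
  case: ifPn => [|_]; last by case: ifPn => // /set_mem Dp; apply: vol0; right.
  by move=> /set_mem[[//|Dp _]]; rewrite mem_set.
Qed.

Definition borel_sets : set (set 'rV[R]_n) := <<s [set A | open A] >>.
Definition borel : choiceType := borel_sets.

Definition borel_of (A : set 'rV[R]_n) (bA : borel_sets A) : borel :=
  SigSub (mem_set bA).

Lemma borelP (A : borel) : borel_sets (val A).
Proof. exact/set_mem/(valP A). Qed.

Lemma borel0_subproof : borel_sets set0.
Proof. exact: (@measurable0 _ (g_sigma_algebraType [set A | open A])). Qed.
Definition borel0 : borel := borel_of borel0_subproof.

Lemma borelU_subproof (A B : borel) : borel_sets (val A `|` val B).
Proof.
exact: (@measurableU _ (g_sigma_algebraType [set A | open A])
  _ _ (borelP A) (borelP B)).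
Qed.
Definition borelU (A B : borel) : borel := borel_of (borelU_subproof A B).

Lemma borelI_subproof (A B : borel) : borel_sets (val A `&` val B).
Proof.
exact: (@measurableI _ (g_sigma_algebraType [set A | open A])
  _ _ (borelP A) (borelP B)).
Qed.
Definition borelI (A B : borel) : borel := borel_of (borelI_subproof A B).

Definition equal_mod_negligible (A B : borel) : bool :=
  `[< lebesgue_negligible (val A `+` val B) >].

Lemma equal_mod_negligible_refl : reflexive equal_mod_negligible.
Proof.
by move=> A; apply/asboolP; rewrite setYK; exact: lebesgue_negligible0.
Qed.

Lemma equal_mod_negligible_sym : symmetric equal_mod_negligible.
Proof. by move=> A B; rewrite /equal_mod_negligible setYC. Qed.

Lemma equal_mod_negligible_trans : transitive equal_mod_negligible.
Proof.
move=> B A C /asboolP nAB /asboolP nBC; apply/asboolP.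
apply: lebesgue_negligibleS (lebesgue_negligibleU nAB nBC) => t.
rewrite /setY /=; have [Bt|nBt] := pselect (val B t).
  by move=> [[At nCt]|[Ct nAt]]; [right; left|left; right].
by move=> [[At nCt]|[Ct nAt]]; [left; left|right; right].
Qed.

Canonical equal_mod_negligible_equiv := EquivRel equal_mod_negligible
  equal_mod_negligible_refl equal_mod_negligible_sym equal_mod_negligible_trans.

Definition Bint := {eq_quot equal_mod_negligible}.
HB.instance Definition _ : EqQuotient borel equal_mod_negligible Bint :=
  EqQuotient.on Bint.
HB.instance Definition _ := Choice.on Bint.

Definition BintU : Bint -> Bint -> Bint := lift_op2 Bint borelU.
Definition BintI : Bint -> Bint -> Bint := lift_op2 Bint borelI.

Lemma pi_BintU : {morph \pi_Bint : A B / borelU A B >-> BintU A B}.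
Proof.
move=> A B; unlock BintU; apply/eqmodP/asboolP.
have /eqmodP/asboolP nA : A = repr (\pi_Bint A) %[mod Bint] by rewrite reprK.
have /eqmodP/asboolP nB : B = repr (\pi_Bint B) %[mod Bint] by rewrite reprK.
apply: lebesgue_negligibleS (lebesgue_negligibleU nA nB) => t.
rewrite /setY /=.
have := pselect (sval A t); have := pselect (sval B t).
have := pselect (sval (repr (\pi_Bint A)) t).
have := pselect (sval (repr (\pi_Bint B)) t).
tauto.
Qed.
Canonical pi_BintU_morph := PiMorph2 pi_BintU.

Lemma pi_BintI : {morph \pi_Bint : A B / borelI A B >-> BintI A B}.
Proof.
move=> A B; unlock BintI; apply/eqmodP/asboolP.
have /eqmodP/asboolP nA : A = repr (\pi_Bint A) %[mod Bint] by rewrite reprK.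
have /eqmodP/asboolP nB : B = repr (\pi_Bint B) %[mod Bint] by rewrite reprK.
apply: lebesgue_negligibleS (lebesgue_negligibleU nA nB) => t.
rewrite /setY /=.
have := pselect (sval A t); have := pselect (sval B t).
have := pselect (sval (repr (\pi_Bint A)) t).
have := pselect (sval (repr (\pi_Bint B)) t).
tauto.
Qed.
Canonical pi_BintI_morph := PiMorph2 pi_BintI.

Definition Bint0 : Bint := \pi_Bint borel0.

Lemma BintUA : associative BintU.
Proof.
elim/quotW => A; elim/quotW => B; elim/quotW => C.
by rewrite -!pi_BintU; congr (\pi_Bint _); apply: val_inj; rewrite /= setUA.
Qed.

Lemma BintUC : commutative BintU.
Proof.
elim/quotW => A; elim/quotW => B.
by rewrite -!pi_BintU; congr (\pi_Bint _); apply: val_inj; rewrite /= setUC.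
Qed.

Lemma Bint0U : left_id Bint0 BintU.
Proof.
elim/quotW => A.
by rewrite -!pi_BintU; congr (\pi_Bint _); apply: val_inj; rewrite /= set0U.
Qed.

Lemma BintU0 : right_id Bint0 BintU.
Proof. by move=> A; rewrite BintUC Bint0U. Qed.

Lemma BintU_eq0 A B : BintU A B = Bint0 -> A = Bint0 /\ B = Bint0.
Proof.
elim/quotW: A => A; elim/quotW: B => B; rewrite -pi_BintU.
move/eqmodP/asboolP; rewrite setY0 => nAB.
by split; apply/eqmodP/asboolP; rewrite setY0;
  apply: lebesgue_negligibleS nAB => t; [left|right].
Qed.

(* [malg Bint K] is then a commutative K-algebra, in which the product of two
   basis elements is their union *)
HB.instance Definition _ :=
  Choice_isMonomialDef.Build Bint BintUA Bint0U BintU0 BintU_eq0.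
HB.instance Definition _ := MonomialDef_isConomialDef.Build Bint BintUC.

End BorelMod.

Arguments lebesgue_negligible {R n}.
Arguments BintU {R n}.
Arguments BintI {R n}.

Section FrakB.
Variables (R : realType) (K : fieldType) (n : nat).
Local Notation KBint := (malg (Bint R n) K).

Definition inclusion_exclusion (A B : Bint R n) : KBint :=
  mkmalgU (BintU A B) 1 - mkmalgU A 1 - mkmalgU B 1 + mkmalgU (BintI A B) 1.

Definition inclusion_exclusion_ideal : {pred KBint} :=
  fun z => `[< exists s : seq (KBint * (Bint R n * Bint R n)),
    z = \sum_(p <- s) p.1 * inclusion_exclusion p.2.1 p.2.2 >].

Lemma inclusion_exclusion_ideal_submod :
  subsemimod_closed inclusion_exclusion_ideal.
Proof.
split; first split.
- by apply/asboolP; exists [::]; rewrite big_nil.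
- move=> _ _ /asboolP[s ->] /asboolP[t ->]; apply/asboolP; exists (s ++ t).
  by rewrite big_cat.
- move=> a _ /asboolP[s ->]; apply/asboolP.
  exists [seq (a *: p.1, p.2) | p <- s]; rewrite big_map scaler_sumr.
  by apply: eq_bigr => p _ /=; rewrite scalerAl.
Qed.

HB.instance Definition _ := GRing.isSubmodClosed.Build K KBint
  inclusion_exclusion_ideal inclusion_exclusion_ideal_submod.

Definition frakB := @Quotient.quot KBint inclusion_exclusion_ideal.
HB.instance Definition _ := GRing.Zmodule.on frakB.

Definition frakB_pi (z : KBint) : frakB :=
  \pi_(@Quotient.quot KBint inclusion_exclusion_ideal) z.

Definition frakB_scale (a : K) (z : frakB) : frakB := frakB_pi (a *: repr z).

Lemma frakB_piD x y : frakB_pi (x + y) = frakB_pi x + frakB_pi y.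
Proof. exact: raddfD. Qed.

Lemma frakB_pi_eq x y :
  (frakB_pi x == frakB_pi y) = (x - y \in inclusion_exclusion_ideal).
Proof. by rewrite Quotient.idealrBE. Qed.

Lemma frakB_piZ a x : frakB_pi (a *: x) = frakB_scale a (frakB_pi x).
Proof.
apply/eqP; rewrite frakB_pi_eq -scalerBr rpredZ// -frakB_pi_eq.
by rewrite /frakB_pi reprK.
Qed.

Lemma frakB_piK z : frakB_pi (repr z) = z.
Proof. exact: reprK. Qed.

Lemma frakB_scaleA a b z :
  frakB_scale a (frakB_scale b z) = frakB_scale (a * b) z.
Proof. by rewrite -[z]frakB_piK -!frakB_piZ scalerA. Qed.

Lemma frakB_scale1 : left_id 1 frakB_scale.
Proof. by move=> z; rewrite -[z]frakB_piK -frakB_piZ scale1r. Qed.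

Lemma frakB_scaleDr : right_distributive frakB_scale +%R.
Proof.
move=> a y z; rewrite -[y]frakB_piK -[z]frakB_piK -!frakB_piZ -!frakB_piD.
by rewrite -frakB_piZ scalerDr.
Qed.

Lemma frakB_scaleDl z : {morph frakB_scale^~ z : a b / a + b}.
Proof.
by move=> a b; rewrite -[z]frakB_piK -!frakB_piZ -frakB_piD scalerDl.
Qed.

HB.instance Definition _ := GRing.Zmodule_isLmodule.Build K frakB
  frakB_scaleA frakB_scale1 frakB_scaleDr frakB_scaleDl.

Definition frakB_class (A : borel R n) : frakB :=
  frakB_pi (mkmalgU (\pi_(Bint R n) A) 1).

End FrakB.

Section Simplex.
Variables (R : realType) (n : nat).

Definition simplex : set 'rV[R]_n :=
  [set t | (forall i, 0 < t 0 i < 1) /\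
           (forall i j : 'I_n, (i < j)%N -> t 0 i < t 0 j)].

Lemma simplex_borel : borel_sets simplex.
Proof.
apply: sub_sigma_algebra; rewrite /= openE => t [t01 tmono].
have cont i : (fun s : 'rV[R]_n => s 0 i) @ t --> t 0 i.
  exact: coord_continuous.
have nbhs01 : nbhs t [set s : 'rV[R]_n | forall i, 0 < s 0 i < 1].
  apply: (@filter_forall _ 'I_n (fun i (s : 'rV[R]_n) => 0 < s 0 i < 1)
    (nbhs t) _) => i.
  have /andP[ti0 ti1] := t01 i.
  apply: filterS2 (cvgr_gt _ (cont i) _ ti0) (cvgr_lt _ (cont i) _ ti1).
  by move=> s s0 s1; apply/andP; split.
have nbhsmono : nbhs t [set s : 'rV[R]_n |
    forall i j : 'I_n, (i < j)%N -> s 0 i < s 0 j].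
  apply: (@filter_forall _ 'I_n (fun i (s : 'rV[R]_n) =>
    forall j : 'I_n, (i < j)%N -> s 0 i < s 0 j) (nbhs t) _) => i.
  apply: (@filter_forall _ 'I_n (fun j (s : 'rV[R]_n) =>
    (i < j)%N -> s 0 i < s 0 j) (nbhs t) _) => j.
  have [ij|ji] := ltnP i j; last by apply: nearW.
  have tij : 0 < t 0 j - t 0 i by rewrite subr_gt0 tmono.
  apply: filterS (cvgr_gt _ (cvgB (cont j) (cont i)) _ tij) => s /=.
  by rewrite subr_gt0.
exact: filterS2 nbhs01 nbhsmono.
Qed.

End Simplex.

Section FormalIntegral.
Variables (R : realType) (K : fieldType).

Definition open_unit_interval := {t : R | 0 < t < 1}.

Definition integrands := letter -> open_unit_interval -> R.

Definition Gxy : integrands := fun a t =>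
  match a with
  | lx => 1 / sval t
  | ly => 1 / (1 - sval t)
  end.

Definition word_family := forall w : word, frakB R K (size w).
HB.instance Definition _ := Choice.on word_family.

Let wf_zero : word_family := fun w => 0.
Let wf_opp (f : word_family) : word_family := fun w => - f w.
Let wf_add (f g : word_family) : word_family := fun w => f w + g w.
Let wf_scale (a : K) (f : word_family) : word_family := fun w => a *: f w.

Let wf_addA : associative wf_add.
Proof.
by move=> f g h; apply: functional_extensionality_dep => w;
  rewrite /wf_add addrA.
Qed.
Let wf_addC : commutative wf_add.
Proof.
by move=> f g; apply: functional_extensionality_dep => w;
  rewrite /wf_add addrC.
Qed.
Let wf_add0 : left_id wf_zero wf_add.
Proof.
by move=> f; apply: functional_extensionality_dep => w;
  rewrite /wf_add add0r.
Qed.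
Let wf_addN : left_inverse wf_zero wf_opp wf_add.
Proof.
by move=> f; apply: functional_extensionality_dep => w;
  rewrite /wf_add addNr.
Qed.

HB.instance Definition _ := GRing.isZmodule.Build word_family
  wf_addA wf_addC wf_add0 wf_addN.

Let wf_scaleA a b f : wf_scale a (wf_scale b f) = wf_scale (a * b) f.
Proof.
by apply: functional_extensionality_dep => w; rewrite /wf_scale scalerA.
Qed.
Let wf_scale1 : left_id 1 wf_scale.
Proof.
by move=> f; apply: functional_extensionality_dep => w;
  rewrite /wf_scale scale1r.
Qed.
Let wf_scaleDr : right_distributive wf_scale +%R.
Proof.
by move=> a f g; apply: functional_extensionality_dep => w;
  rewrite /wf_scale scalerDr.
Qed.
Let wf_scaleDl f : {morph wf_scale^~ f : a b / a + b}.
Proof.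
by move=> a b; apply: functional_extensionality_dep => w;
  rewrite /wf_scale scalerDl.
Qed.

HB.instance Definition _ := GRing.Zmodule_isLmodule.Build K word_family
  wf_scaleA wf_scale1 wf_scaleDr wf_scaleDl.

Lemma word_familyD (f g : word_family) w : (f + g) w = f w + g w.
Proof. by []. Qed.
Lemma word_familyZ a (f : word_family) w : (a *: f) w = a *: f w.
Proof. by []. Qed.
Lemma word_family0 w : (0 : word_family) w = 0.
Proof. by []. Qed.

Definition finite_word_support : {pred word_family} :=
  fun f => `[< finite_set [set w | f w != 0] >].

Lemma finite_word_support_submod : subsemimod_closed finite_word_support.
Proof.
split; first split.
- apply/asboolP; rewrite (_ : [set w | _] = set0)//.
  by apply/seteqP; split => // w /=; rewrite word_family0 eqxx.
- move=> f g /asboolP ff /asboolP fg; apply/asboolP.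
  apply: (@sub_finite_set _ _ ([set w | f w != 0] `|` [set w | g w != 0])).
    move=> w /=; have [fw|fw] := eqVneq (f w) 0; last by left.
    by rewrite word_familyD fw add0r; right.
  by rewrite finite_setU.
- move=> a f /asboolP ff; apply/asboolP; apply: sub_finite_set ff => w /=.
  by apply: contra_neq => fw; rewrite word_familyZ fw scaler0.
Qed.

HB.instance Definition _ := GRing.isSubmodClosed.Build K word_family
  finite_word_support finite_word_support_submod.

(* Formal integrals with integrands G. The first component of the pair
   (B (x) w, G) lives in the direct sum of the B(R^(size w)) (x) w; since G is
   fixed and the linear structure is that of the first component, G is only a
   (phantom) parameter of the type. *)
Record formal_integral (G : integrands) : Type := FormalIntegral {
  formal_integral_val : word_family;
  _ : formal_integral_val \in finite_word_support }.

Section Fixed.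
Variable G : integrands.

HB.instance Definition _ := [isSub for @formal_integral_val G].
HB.instance Definition _ := [Choice of formal_integral G by <:].
HB.instance Definition _ :=
  [SubChoice_isSubLmodule of formal_integral G by <:].

Lemma tensor_subproof (w : word) (B : frakB R K (size w)) :
  dfwith (fun v : word => 0 : frakB R K (size v)) w B \in finite_word_support.
Proof.
apply/asboolP; apply: (@sub_finite_set _ _ [set w]) => [v /=|]; last first.
  exact: finite_set1.
by apply: contra_neqP => /eqP vw; rewrite dfwithout// eq_sym.
Qed.

(* B (x) w x G, also written as the integral over B of the product of the
   g_(w_i). *)
Definition tensor (w : word) (B : frakB R K (size w)) : formal_integral G :=
  FormalIntegral G (tensor_subproof B).

(* The integral over 0 < t_1 < ... < t_k < 1 of the product of the g_(w_i);
   for the empty word it is (empty set) (x) (empty word) x G. *)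
Definition chain_domain (w : word) : borel R (size w) :=
  if w is [::] then borel0 R (size w) else borel_of (@simplex_borel R (size w)).

Definition chain_integral (w : word) : formal_integral G :=
  tensor (frakB_class K (chain_domain w)).

End Fixed.
End FormalIntegral.

Section ChainAlgebra.
Variables (R : realType) (K : fieldType).
Let FI := formal_integral K (@Gxy R).
Let chain (w : word) : FI := chain_integral K (@Gxy R) w.

Record chain_algebra : Type := ChainAlgebra {
  chain_algebra_val : FI;
  _ : chain_algebra_val \in lin_span chain predT }.

HB.instance Definition _ := [isSub for chain_algebra_val].
HB.instance Definition _ := [Choice of chain_algebra by <:].
HB.instance Definition _ := [SubChoice_isSubLmodule of chain_algebra by <:].

Definition chainA (w : word) : chain_algebra :=
  ChainAlgebra (mem_lin_span chain (erefl : predT w)).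

Lemma chain_algebra_valE c :
  chain_algebra_val (lin_ext chainA c) = lin_ext chain c.
Proof.
pose val_ (a : chain_algebra) : FI := \val a.
have valZ k a : val_ (k *: a) = k *: val_ a by exact: GRing.valZ.
have valD : {morph val_ : a b / a + b} by exact: raddfD.
have val0 : val_ 0 = 0 by exact: raddf0.
rewrite -[LHS]/(val_ _) /lin_ext (big_morph val_ valD val0).
by apply: eq_bigr => w _; rewrite valZ.
Qed.

Lemma chain_algebra_coords (a : chain_algebra) :
  exists c : malg word K, a = lin_ext chainA c.
Proof.
case: a => a aP; have /asboolP[c _ ac] := aP.
by exists c; apply: val_inj; rewrite /= chain_algebra_valE.
Qed.

(* The coordinates in the family [chainA]; they are unique by [chainA_free]
   below. *)
Definition chain_coords (a : chain_algebra) : malg word K :=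
  sval (cid (chain_algebra_coords a)).

(* Permutations are indexed from 0 here: i : 'I_(k + l) stands for i + 1. *)
Definition Sh (k l : nat) : {set 'S_(k + l)} :=
  [set s : 'S_(k + l) | [forall i : 'I_(k + l), forall j : 'I_(k + l),
     (((i < j) && (j < k)) || ((k <= i) && (i < j)))%N ==> (s i < s j)%N]].

Definition permuted_word (u v : word) (s : 'S_(size u + size v)) : word :=
  [seq nth lx (u ++ v) (s^-1%g i) | i <- enum 'I_(size u + size v)].

Definition first_from (n m : nat) (s : 'S_n) : bool :=
  [exists i : 'I_n, (i == 0 :> nat) && (s^-1%g i == m :> nat)].

Definition chain_prec (u v : word) : chain_algebra :=
  match u, v with
  | [::], _ => 0
  | _, [::] => chainA u
  | _, _ => \sum_(s in Sh (size u) (size v) | first_from 0 s)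
              chainA (permuted_word s)
  end.

Definition chain_succ (u v : word) : chain_algebra :=
  match u, v with
  | _, [::] => 0
  | [::], _ => chainA v
  | _, _ => \sum_(s in Sh (size u) (size v) | first_from (size u) s)
              chainA (permuted_word s)
  end.

Definition chain_star (u v : word) : chain_algebra :=
  match u, v with
  | [::], _ => chainA v
  | _, [::] => chainA u
  | _, _ => chain_prec u v + chain_succ u v
  end.

Definition chain_bilin (f : word -> word -> chain_algebra)
    (a b : chain_algebra) : chain_algebra :=
  bilin_ext f (chain_coords a) (chain_coords b).

Definition chain_integrals : aug_data K := {|
  aug_space := chain_algebra;
  aug_one := chainA [::];
  aug_part := lin_span chainA (fun w => w != [::]);
  aug_prec := chain_bilin chain_prec;
  aug_succ := chain_bilin chain_succ;
  aug_star := chain_bilin chain_star |}.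

Definition zeta_FI : {linear shuffle_words K -> chain_integrals} :=
  lin_ext chainA.

Lemma zeta_FIE (w : word) : zeta_FI (mkmalgU w 1) = chainA w.
Proof. exact: lin_extU. Qed.

(* The family [chainA] is linearly independent, so that the operations of
   [chain_integrals] are bilinear and take the prescribed values on it. The
   point is that the sum of coefficients on K B_int(R^n) vanishes on the ideal
   defining B(R^n), hence no Borel class is zero there. *)

Lemma weight_ideal n (z : malg (Bint R n) K) :
  inclusion_exclusion_ideal z -> weight z = 0.
Proof.
move=> /asboolP[s ->]; rewrite raddf_sum big1_seq// => -[c [A B]] _ /=.
exact: weight_alternating.
Qed.

Lemma frakB_class_neq0 n (A : borel R n) : frakB_class K A != 0.
Proof.
rewrite /frakB_class -[0](raddf0 (\pi_(Quotient.quot _))) frakB_pi_eq subr0.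
apply/negP => /weight_ideal; rewrite weightU.
exact/eqP/oner_neq0.
Qed.

Lemma lin_ext_chain_eval (c : malg word K) w :
  formal_integral_val (lin_ext chain c) w =
  mcoeff w c *: frakB_class K (chain_domain R w).
Proof.
pose ev (f : FI) := formal_integral_val f w.
pose val_ (f : FI) : word_family R K := \val f.
have valD : {morph val_ : f g / f + g} by exact: raddfD.
have valZ a f : val_ (a *: f) = a *: val_ f by exact: GRing.valZ.
have val0 : val_ 0 = 0 by exact: raddf0.
have evE f : ev f = val_ f w by [].
have evD : {morph ev : f g / f + g}.
  by move=> f g; rewrite !evE valD word_familyD.
have ev0 : ev 0 = 0 by rewrite evE val0 word_family0.
have evZ a f : ev (a *: f) = a *: ev f by rewrite !evE valZ word_familyZ.
rewrite -/(ev _) /lin_ext (big_morph ev evD ev0).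
have evU v : v != w -> ev (chain v) = 0.
  by move=> vw; rewrite /ev /= dfwithout.
have evw : ev (chain w) = frakB_class K (chain_domain R w).
  by rewrite /ev /= dfwithin.
have [wc|wc] := boolP (w \in msupp c); last first.
  rewrite (mcoeff_outdom wc) scale0r big_seq big1// => v vc.
  rewrite evZ evU ?scaler0//; apply: contraNneq wc => <-; exact: vc.
rewrite (big_fsetD1 w) // evZ evw big_seq big1 => [|v]; first exact: addr0.
by rewrite in_fsetD1 => /andP[vw _]; rewrite evZ evU ?scaler0.
Qed.

Lemma chainA_free : injective (lin_ext chainA).
Proof.
move=> c d cd; apply/malgP => w.
have : formal_integral_val (lin_ext chain c) w =
       formal_integral_val (lin_ext chain d) w by
  rewrite -!chain_algebra_valE cd.
rewrite !lin_ext_chain_eval => /eqP; rewrite -subr_eq0 -scalerBl scaler_eq0.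
by rewrite (negPf (frakB_class_neq0 _)) orbF subr_eq0 => /eqP.
Qed.

Lemma chain_coordsK : cancel (lin_ext chainA) chain_coords.
Proof.
by move=> c; apply: chainA_free; rewrite /chain_coords; case: cid => d /= <-.
Qed.

Lemma chain_bilinE f u v : chain_bilin f (chainA u) (chainA v) = f u v.
Proof.
rewrite /chain_bilin -[chainA u](lin_extU chainA) -[chainA v](lin_extU chainA).
by rewrite !chain_coordsK /bilin_ext !lin_extU.
Qed.

End ChainAlgebra.

(* Main.v *)
(* A permutation s in Sh(k, l) satisfies s^-1(1) = 1 or s^-1(1) = k + 1, and
   deleting that index gives a bijection onto Sh(k - 1, l), resp. Sh(k, l - 1).
   This is the recursion defining the shuffle product, so zeta_FI carries the
   two half-shuffles of words to those of chain integrals. On words,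
   (a.u) < v = a.(u * v) and u > (b.v) = b.(u * v), so the dendriform axioms
   all reduce to associativity of the shuffle product. As the chain integrals
   are linearly independent, zeta_FI is bijective, and the axioms transport to
   the target. *)

Require Import Defs.
From mathcomp Require Import all_boot all_order all_fingroup all_algebra.
From mathcomp Require Import finmap zify.
From mathcomp Require Import all_classical all_reals.
From mathcomp.multinomials Require Import -(notations) monalg.

Set Implicit Arguments.
Unset Strict Implicit.
Unset Printing Implicit Defensive.

Import GRing.Theory.

Local Open Scope ring_scope.

(** * Shuffle permutations *)

(** Deleting [i] from the source and [s i] from the target leaves an injection [f] of ['I_n], hence
    a permutation. Since [s (lift i k)] differs from [s i], [unlift] always succeeds and the default
    in [odflt] is never taken. *)
Lemma lift_perm_surj n (i j : 'I_n.+1) (s : 'S_n.+1) :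
  s i = j -> exists t, lift_perm i j t = s.
Proof.
move=> <-; pose f k := odflt k (unlift (s i) (s (lift i k))).
have fK k : lift (s i) (f k) = s (lift i k).
  have := neq_lift i k; rewrite /f -(inj_eq (@perm_inj _ s)).
  by move=> /unlift_some[l e ->].
have f_inj : injective f.
  by move=> k l kl; apply/(@lift_inj _ i)/(@perm_inj _ s); rewrite -!fK kl.
exists (perm f_inj); apply/permP => k.
case: (unliftP i k) => [l|] ->; last by rewrite lift_perm_id.
by rewrite lift_perm_lift permE fK.
Qed.

Lemma lift_perm_inj n (i j : 'I_n.+1) : injective (lift_perm i j).
Proof.
move=> s t st; apply/permP => k; apply/(@lift_inj _ j).
by rewrite -!(lift_perm_lift i) st.
Qed.

Section Permutations.
Local Open Scope nat_scope.

(* [Sh k l] is [shuffles k (k + l)]; letting n vary freely avoids casts when a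
   letter is removed. *)
Definition shuffles (k n : nat) : {set 'S_n} :=
  [set s : 'S_n | [forall i : 'I_n, forall j : 'I_n,
     ((i < j) && (j < k)) || ((k <= i) && (i < j)) ==> (s i < s j)]].

Definition permute n (t : seq letter) (s : 'S_n) : seq letter :=
  [seq nth lx t (s^-1%g i) | i <- enum 'I_n].

Lemma shufflesP k n (s : 'S_n) :
  reflect (forall i j : 'I_n, i < j -> (j < k) || (k <= i) -> s i < s j)
          (s \in shuffles k n).
Proof.
rewrite inE; apply: (iffP forallP) => [sh i j ij c|sh i].
  by have /forallP/(_ j)/implyP := sh i; apply; rewrite ij andbT.
apply/forallP => j; apply/implyP => /orP[]/andP[c d]; apply: sh => //.
  by rewrite d.
by rewrite c orbT.
Qed.

Lemma first_fromE (n m : nat) (j : 'I_n.+1) (s : 'S_n.+1) :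
  m = j -> first_from m s = (s j == ord0).
Proof.
move=> ->; apply/existsP/eqP => [[i /andP[/eqP i0 /eqP ij]]|sj].
  have -> : j = (s^-1)%g i by apply/val_inj; rewrite /= ij.
  by rewrite permKV; apply/val_inj.
by exists ord0; rewrite /= -sj permK eqxx.
Qed.

(** The hypothesis says that [j] opens one of the two blocks. As 0 is the least value, every
    inequality involving [j] is then automatic, and the others are those of [s], with the first
    block one shorter exactly when [j] lay in it. *)
Lemma lift_perm_shuffles k n (j : 'I_n.+1) (s : 'S_n) :
  (j = k :> nat) \/ (j = 0 :> nat /\ 0 < k) ->
  (lift_perm j ord0 s \in shuffles k n.+1) = (s \in shuffles (k - (j < k)) n).
Proof.
move=> jk; apply/shufflesP/shufflesP => sh a b ab c.
  have := sh (lift j a) (lift j b).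
  rewrite !lift_perm_lift !lift0 ltnS; apply; rewrite /= /bump; lia.
case: (unliftP j b) c ab => [b' ->|->]; last first.
  by case: (unliftP j a) => [a' ->|->] /=; rewrite /bump; lia.
case: (unliftP j a) => [a' ->|->]; last first.
  by rewrite lift_perm_id lift_perm_lift lift0.
rewrite !lift_perm_lift !lift0 ltnS /= /bump => c ab.
by apply: sh; lia.
Qed.

(** An index preceding [j] in its own block would need an image below 0. *)
Lemma first_from_shuffles k n (s : 'S_n.+1) : s \in shuffles k n.+1 ->
  forall j : 'I_n.+1, s j = ord0 -> j = k :> nat \/ (j = 0 :> nat /\ 0 < k).
Proof.
move=> /shufflesP sh j sj.
have [kj|jk|] := ltngtP j k; last by left.
- right; split; last by lia.
  apply/eqP; rewrite -leqn0 leqNgt; apply/negP => j0.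
  by have := sh ord0 j j0; rewrite sj kj ltn0 => /(_ isT).
- have kn : k < n.+1 by rewrite (ltn_trans jk).
  by have := sh (Ordinal kn) j jk; rewrite sj /= leqnn orbT ltn0 => /(_ isT).
Qed.

(** [permute] reads letters through the inverse permutation, which here sends 0 to [j] and otherwise
    skips [j]. *)
Lemma permute_lift n t (j : 'I_n.+1) (s : 'S_n) : j < size t ->
  permute t (lift_perm j ord0 s) =
  nth lx t j :: permute (take j t ++ drop j.+1 t) s.
Proof.
move=> jt; rewrite /permute enum_ordSl /= lift_permV lift_perm_id.
congr cons; rewrite -map_comp; apply: eq_map => i /=.
rewrite lift_perm_lift nth_cat size_take jt nth_drop /= /bump.
case: ltnP => ij; first by rewrite nth_take.
by rewrite add1n addSn subnKC.
Qed.

End Permutations.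

Section Sums.
Variables (V : nmodType) (n : nat).

Lemma sum_first_from (k m : nat) (j : 'I_n.+1) (F : 'S_n.+1 -> V) :
  m = j -> (j = k :> nat) \/ (j = 0 :> nat /\ 0 < k)%N ->
  \sum_(s in shuffles k n.+1 | first_from m s) F s =
  \sum_(s in shuffles (k - (j < k)) n) F (lift_perm j ord0 s).
Proof.
move=> mj jk; under eq_bigl do rewrite (first_fromE _ mj).
(* Inverse of [lift_perm j ord0] on the permutations sending [j] to 0; on all others it takes the
   value 1. *)
pose h (s : 'S_n.+1) : 'S_n := odflt 1%g [pick t | lift_perm j ord0 t == s].
have hK (s : 'S_n.+1) : s j = ord0 -> lift_perm j ord0 (h s) = s.
  move=> /lift_perm_surj[t ts]; rewrite /h; case: pickP => [t' /eqP//|/(_ t)].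
  by rewrite ts eqxx.
rewrite (reindex_onto (lift_perm j ord0) h) => [|s /andP[_ /eqP]].
  2: exact: hK.
apply: eq_bigl => s; rewrite lift_perm_shuffles// lift_perm_id eqxx andbT.
suff -> : h (lift_perm j ord0 s) = s by rewrite eqxx andbT.
by apply/(@lift_perm_inj _ j ord0)/hK; rewrite lift_perm_id.
Qed.

(** The guards say that the first, resp. second, block is nonempty. For [k = 0] both conditions read
    [first_from 0], and the guard keeps those permutations from being counted twice. *)
Lemma sum_shuffles_first k (F : 'S_n.+1 -> V) :
  \sum_(s in shuffles k n.+1) F s =
  (if (0 < k)%N then \sum_(s in shuffles k n.+1 | first_from 0 s) F s else 0) +
  (if (k <= n)%N then \sum_(s in shuffles k n.+1 | first_from k s) F s else 0).
Proof.
have first0 (s : 'S_n.+1) : first_from 0 s = (s ord0 == ord0).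
  exact: first_fromE.
have first_pos (s : 'S_n.+1) : s \in shuffles k n.+1 ->
    first_from 0 s \/ (s^-1)%g ord0 = k :> nat.
  move=> sh; case: (first_from_shuffles sh (permKV s ord0)); first by right.
  move=> [s0 _]; left; rewrite first0 -[X in _ == X](permKV s).
  by rewrite (inj_eq (@perm_inj _ s)) -val_eqE /= s0.
have [k0|k0] := posnP k.
  rewrite k0 add0r /=; apply: eq_bigl => s; apply/esym/andb_idr => sh.
  rewrite first0 -[X in _ == X](permKV s) (inj_eq (@perm_inj _ s)) -val_eqE /=.
  by case: (first_from_shuffles sh (permKV s ord0)) => [->|[]].
rewrite (bigID (first_from 0)) /=; congr (_ + _).
case: leqP => kn; last first.
  apply: big1 => s /andP[/first_pos[->//|sk] _].
  by have := ltn_ord ((s^-1)%g ord0); rewrite sk; lia.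
pose j : 'I_n.+1 := Ordinal (kn : (k < n.+1)%N).
apply: eq_bigl => s; apply: andb_id2l => sh.
rewrite (@first_fromE _ k j)//; apply/idP/eqP => [s0|sj].
  case: (first_pos s sh) => [s0'|sk]; first by rewrite s0' in s0.
  by rewrite (_ : j = (s^-1)%g ord0) ?permKV//; apply/val_inj; rewrite /= -sk.
by rewrite first0 -[X in _ != X]sj (inj_eq (@perm_inj _ s)) -val_eqE /=; lia.
Qed.

End Sums.

(** * Linear and bilinear extension from a basis *)

Lemma linear_lin_ext (K : fieldType) (I : choiceType) (V W : lmodType K)
    (h : {linear V -> W}) (f : I -> V) c :
  h (lin_ext f c) = lin_ext (fun k => h (f k)) c.
Proof.
by rewrite /lin_ext linear_sum; apply: eq_bigr => k _; exact: linearZ_LR.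
Qed.

Lemma eq_lin_ext (K : fieldType) (I : choiceType) (V : lmodType K)
    (f g : I -> V) : f =1 g -> lin_ext f =1 lin_ext g.
Proof. by move=> fg c; apply: eq_bigr => k _; rewrite fg. Qed.

Lemma word_nil_star (K : fieldType) v : word_star K [::] v = mkmalgU v 1.
Proof. by case: v. Qed.

Lemma word_star_nil (K : fieldType) u : word_star K u [::] = mkmalgU u 1.
Proof. by case: u. Qed.

Section FreeModule.
Variables (K : fieldType) (I : choiceType).

Lemma lin_ext_mkmalgU (c : malg I K) : lin_ext (fun k => mkmalgU k 1) c = c.
Proof.
rewrite [RHS]monalgE; apply: eq_bigr => k _.
by apply/malgP => l; rewrite mcoeffZ !mcoeffU mulrnAr mulr1.
Qed.

(** Linearity is a hypothesis on plain functions, so that the lemma applies to one argument of a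
    bilinear expression at a time. *)
Lemma eq_linear (V : lmodType K) (h h' : malg I K -> V) :
  linear h -> linear h' ->
  (forall i, h (mkmalgU i 1) = h' (mkmalgU i 1)) -> forall c, h c = h' c.
Proof.
have linear0 (g : malg I K -> V) : linear g -> g 0 = 0.
  by move=> lg; have := lg (-1) 0 0; rewrite !scaleN1r oppr0 addr0 addNr.
move=> lh lh' hU c; rewrite -[c]lin_ext_mkmalgU /lin_ext.
(* The support becomes an arbitrary list, with the coefficients still those of [c], to allow
   induction on it. *)
move: (enum_fset (msupp c)) => s.
elim: s => [|i s IHs]; first by rewrite big_nil !linear0.
by rewrite big_cons lh lh' hU IHs.
Qed.

Lemma linear_add (V : lmodType K) (h h' : malg I K -> V) :
  linear h -> linear h' -> linear (fun c => h c + h' c).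
Proof. by move=> lh lh' k c d; rewrite lh lh' scalerDr addrACA. Qed.

End FreeModule.

Section BilinearExtension.
Variables (K : fieldType) (I : choiceType) (V : lmodType K) (f : I -> I -> V).
Implicit Types c d : malg I K.

Lemma bilin_extU u v : bilin_ext f (mkmalgU u 1) (mkmalgU v 1) = f u v.
Proof. by rewrite /bilin_ext !lin_extU. Qed.

Lemma bilin_extPl k c c' d :
  bilin_ext f (k *: c + c') d = k *: bilin_ext f c d + bilin_ext f c' d.
Proof. exact: linearP. Qed.

Lemma bilin_extPr k c d d' :
  bilin_ext f c (k *: d + d') = k *: bilin_ext f c d + bilin_ext f c d'.
Proof.
rewrite /bilin_ext /lin_ext scaler_sumr -big_split /=; apply: eq_bigr => i _.
rewrite scalerA [k * _]mulrC -scalerA -scalerDr; congr (_ *: _).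
exact: (@lin_ext_linear K I V (f i) k d d').
Qed.

Lemma bilin_extDl c c' d :
  bilin_ext f (c + c') d = bilin_ext f c d + bilin_ext f c' d.
Proof. exact: raddfD. Qed.

Lemma bilin_extDr c d d' :
  bilin_ext f c (d + d') = bilin_ext f c d + bilin_ext f c d'.
Proof. by have := bilin_extPr 1 c d d'; rewrite !scale1r. Qed.

End BilinearExtension.

Lemma bilin_ext_bilinear (K : fieldType) (I : choiceType)
    (P : pred (malg I K)) (f : I -> I -> malg I K) :
  bilinear_on P (bilin_ext f).
Proof.
by split=> k c c' d _ _ _; [exact: bilin_extPl | exact: bilin_extPr].
Qed.

Lemma linear_bilin_ext (K : fieldType) (I : choiceType) (V W : lmodType K)
    (h : {linear V -> W}) (f : I -> I -> V) c d :
  h (bilin_ext f c d) = bilin_ext (fun u v => h (f u v)) c d.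
Proof.
rewrite /bilin_ext linear_lin_ext; apply: eq_lin_ext => u.
exact: linear_lin_ext.
Qed.

Lemma eq_bilin_ext (K : fieldType) (I : choiceType) (V : lmodType K)
    (f g : I -> I -> V) : f =2 g -> bilin_ext f =2 bilin_ext g.
Proof. by move=> fg c d; apply: eq_lin_ext => u; apply: eq_lin_ext => v. Qed.

(** * Dendriform axioms for half-shuffles *)

(* The operations are abstract here because unification against sums in
   [malg word K] would unfold the concrete ones, which is prohibitively slow. *)
Section HalfShuffles.
Variables (W : nmodType) (L : Type) (cons : L -> W -> W).
Variables (star prec succ : W -> W -> W).
Hypothesis consD : forall a x y, cons a (x + y) = cons a x + cons a y.
Hypothesis starDl : forall x y z, star (x + y) z = star x z + star y z.
Hypothesis starDr : forall x y z, star x (y + z) = star x y + star x z.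
Hypothesis precDl : forall x y z, prec (x + y) z = prec x z + prec y z.
Hypothesis succDl : forall x y z, succ (x + y) z = succ x z + succ y z.
Hypothesis succDr : forall x y z, succ x (y + z) = succ x y + succ x z.
Hypothesis prec_cons : forall a x y, prec (cons a x) y = cons a (star x y).
Hypothesis succ_cons : forall b x y, succ x (cons b y) = cons b (star x y).
Hypothesis cons_star : forall a x y,
  star (cons a x) y = prec (cons a x) y + succ (cons a x) y.

Lemma cons_star_cons a b x y :
  star (cons a x) (cons b y) =
  cons a (star x (cons b y)) + cons b (star (cons a x) y).
Proof. by rewrite cons_star prec_cons succ_cons. Qed.

(** Both sides split into three terms according to which of [a], [b], [c] comes first; each
    hypothesis is associativity after removal of one of these letters. *)
Lemma cons_starA a b c x y z :
  star (star x (cons b y)) (cons c z) = star x (star (cons b y) (cons c z)) ->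
  star (star (cons a x) y) (cons c z) = star (cons a x) (star y (cons c z)) ->
  star (star (cons a x) (cons b y)) z = star (cons a x) (star (cons b y) z) ->
  star (star (cons a x) (cons b y)) (cons c z) =
  star (cons a x) (star (cons b y) (cons c z)).
Proof.
move=> ea eb ec.
rewrite [in LHS](cons_star_cons a b) starDl ![in LHS]cons_star_cons addrACA.
(* Of the four terms, the two beginning with [c] recombine into one; on the right-hand side the two
   beginning with [a] do. *)
rewrite -consD -starDl -(cons_star_cons a b) ec ea eb.
rewrite [in RHS](cons_star_cons b c) [in RHS]starDr ![in RHS]cons_star_cons.
by rewrite [in RHS]addrACA -[in RHS]consD -[in RHS]starDr -cons_star_cons addrA.
Qed.

Section Words.
Variable e : seq L -> W.
Hypothesis eE : forall a w, e (a :: w) = cons a (e w).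
Hypothesis star_1l : forall x, star (e [::]) x = x.
Hypothesis star_1r : forall x, star x (e [::]) = x.

(** Induction on the total length: an empty word acts as the unit, and otherwise each hypothesis of
    [cons_starA] concerns a triple with one letter fewer. *)
Lemma star_wordA u v w :
  star (star (e u) (e v)) (e w) = star (e u) (star (e v) (e w)).
Proof.
have [n] := ubnP (size u + size v + size w); elim: n u v w => // n IHn.
case=> [|a u] [|b v] [|c w]; rewrite ?star_1l ?star_1r//= => uvwn.
have IHa := IHn u (b :: v) (c :: w); have IHb := IHn (a :: u) v (c :: w).
have IHc := IHn (a :: u) (b :: v) w; move: uvwn IHa IHb IHc; rewrite /= !eE.
move=> uvwn IHa IHb IHc.
by apply: cons_starA; [apply: IHa|apply: IHb|apply: IHc]; lia.
Qed.

End Words.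

Hypothesis starA : associative star.
Variables a b : L.
(** Abstract form of the augmentation part over a two-letter alphabet: [nonemptyP] brings
    combinations of nonempty words to this shape. *)
Let part x := exists x1 x2, x = cons a x1 + cons b x2.

Lemma part_star x y : part x -> star x y = prec x y + succ x y.
Proof.
by move=> [x1 [x2 ->]]; rewrite starDl precDl succDl !cons_star addrACA.
Qed.

(** For [x = cons a x1] both sides are [cons a] of the triple product of [x1], [y], [z]. In the next
    two axioms the leading letter of [y], resp. [z], comes out in the same way. *)
Lemma half_prec_prec x y z : part x -> part y ->
  prec (prec x y) z = prec x (prec y z + succ y z).
Proof.
move=> [x1 [x2 ->]] /part_star <-.
by rewrite !precDl !prec_cons !starA.
Qed.

Lemma half_succ_prec x y z : part y ->
  prec (succ x y) z = succ x (prec y z).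
Proof.
move=> [y1 [y2 ->]].
by rewrite precDl succDr !succ_cons precDl !prec_cons succDr !succ_cons !starA.
Qed.

Lemma half_star_succ x y z : part x -> part z ->
  succ (prec x y + succ x y) z = succ x (succ y z).
Proof.
move=> /part_star <- [z1 [z2 ->]].
by rewrite !succDr !succ_cons !starA.
Qed.

End HalfShuffles.

(** * The augmented dendriform algebra of words *)

Section ShuffleAlgebra.
Variable K : fieldType.
Implicit Types (a b : letter) (u v w : word) (x y z : malg word K).

Local Notation wordv w := (mkmalgU w 1 : malg word K).
Local Notation star := (bilin_ext (word_star K)).
Local Notation prec := (bilin_ext (word_prec K)).
Local Notation succ := (bilin_ext (word_succ K)).
Local Notation nonempty := (lin_span (fun w => wordv w) (fun w => w != [::])).

Lemma cons_letterU a w : cons_letter a (wordv w) = wordv (a :: w).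
Proof. exact: lin_extU. Qed.

Lemma cons_letterP a k x y :
  cons_letter a (k *: x + y) = k *: cons_letter a x + cons_letter a y.
Proof. exact: linearP. Qed.

Lemma cons_letterD a x y :
  cons_letter a (x + y) = cons_letter a x + cons_letter a y.
Proof. exact: raddfD. Qed.

Lemma cons_letter0 a : cons_letter a 0 = 0 :> malg word K.
Proof. exact: raddf0. Qed.

Lemma star_1l x : star (wordv [::]) x = x.
Proof.
move: x; apply: eq_linear => [k x y|//|w]; first exact: bilin_extPr.
by rewrite bilin_extU; case: w.
Qed.

Lemma star_1r x : star x (wordv [::]) = x.
Proof.
move: x; apply: eq_linear => [k x y|//|w]; first exact: bilin_extPl.
by rewrite bilin_extU; case: w.
Qed.

Lemma prec_1l x : prec (wordv [::]) x = 0.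
Proof.
move: x; apply: eq_linear => [k x y|k x y|w]; first exact: bilin_extPr.
  by rewrite scaler0 addr0.
by rewrite bilin_extU.
Qed.

Lemma succ_1r x : succ x (wordv [::]) = 0.
Proof.
move: x; apply: eq_linear => [k x y|k x y|w]; first exact: bilin_extPl.
  by rewrite scaler0 addr0.
by rewrite bilin_extU; case: w.
Qed.

Lemma prec_cons a x y : prec (cons_letter a x) y = cons_letter a (star x y).
Proof.
move: x; apply: eq_linear => [k x x'|k x x'|u].
- by rewrite cons_letterP bilin_extPl.
- by rewrite bilin_extPl cons_letterP.
rewrite cons_letterU; move: y; apply: eq_linear => [k y y'|k y y'|v].
- exact: bilin_extPr.
- by rewrite bilin_extPr cons_letterP.
rewrite !bilin_extU; case: v => [|b v] //=.
by rewrite word_star_nil cons_letterU.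
Qed.

Lemma succ_cons b x y : succ x (cons_letter b y) = cons_letter b (star x y).
Proof.
move: x; apply: eq_linear => [k x x'|k x x'|u].
- exact: bilin_extPl.
- by rewrite bilin_extPl cons_letterP.
move: y; apply: eq_linear => [k y y'|k y y'|v].
- by rewrite cons_letterP bilin_extPr.
- by rewrite bilin_extPr cons_letterP.
rewrite cons_letterU !bilin_extU; case: u => [|a u] //.
by rewrite word_nil_star cons_letterU.
Qed.

(** Two empty words are excluded: there both half-products are 0, while the shuffle product is the
    empty word. *)
Lemma word_starE u v : (u != [::]) || (v != [::]) ->
  word_star K u v = word_prec K u v + word_succ K u v.
Proof. by case: u v => [|a u] [|b v] //= _; rewrite ?add0r ?addr0. Qed.

Lemma cons_letter_star a x y :
  star (cons_letter a x) y =
  prec (cons_letter a x) y + succ (cons_letter a x) y.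
Proof.
have linl f : linear (fun x => bilin_ext f (cons_letter a x) y : malg word K).
  by move=> k x1 x2; rewrite cons_letterP bilin_extPl.
move: x; apply: eq_linear => [||u]; first exact: linl.
  exact/linear_add/linl/linl.
rewrite cons_letterU; move: y {linl}; apply: eq_linear => [||v].
- by move=> k y y'; exact: bilin_extPr.
- by apply: linear_add => k y y'; exact: bilin_extPr.
rewrite !bilin_extU; exact: word_starE.
Qed.

Lemma word_starA u v w :
  star (star (wordv u) (wordv v)) (wordv w) =
  star (wordv u) (star (wordv v) (wordv w)).
Proof.
have eE a t : wordv (a :: t) = cons_letter a (wordv t) by rewrite cons_letterU.
exact: (star_wordA (e := fun t => wordv t) cons_letterD (bilin_extDl _)
  (bilin_extDr _) prec_cons succ_cons cons_letter_star eE star_1l star_1r).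
Qed.

Lemma starA : associative star.
Proof.
move=> x y z; apply/esym; move: x; apply: eq_linear => [k x x'|k x x'|u].
- by rewrite bilin_extPl bilin_extPl.
- exact: bilin_extPl.
move: y; apply: eq_linear => [k y y'|k y y'|v].
- by rewrite bilin_extPr bilin_extPl.
- by rewrite bilin_extPl bilin_extPr.
move: z; apply: eq_linear => [k z z'|k z z'|w].
- exact: bilin_extPr.
- by rewrite bilin_extPr bilin_extPr.
exact: word_starA.
Qed.

Lemma cons_letter_nonempty a x : nonempty (cons_letter a x).
Proof.
rewrite -[nonempty _]/(cons_letter a x \in nonempty).
rewrite /cons_letter /lin_ext rpred_sum// => w _.
apply: rpredZ; exact: (@mem_lin_span _ _ _ (fun w => wordv w) _ (a :: w)).
Qed.

(** The words in the support are grouped by their first letter. *)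
Lemma nonemptyP z : nonempty z ->
  exists x y, z = cons_letter lx x + cons_letter ly y.
Proof.
move=> /asboolP[c cP ->]; rewrite /lin_ext big_seq.
apply: (big_ind (fun z => exists x y, z = cons_letter lx x + cons_letter ly y))
  => [|_ _ [x [y ->]] [x' [y' ->]]|w /cP].
- by exists 0, 0; rewrite !cons_letter0 addr0.
- by exists (x + x'), (y + y'); rewrite !cons_letterD; exact: addrACA.
case: w => [//|[] w] _; [exists (mcoeff (lx :: w) c *: wordv w), 0|
                         exists 0, (mcoeff (ly :: w) c *: wordv w)].
(* Adding 0 gives the multiple the shape [k *: x + y] that [cons_letterP] expects. *)
- rewrite cons_letter0 addr0 -cons_letterU -[_ *: wordv w]addr0.
  by rewrite cons_letterP cons_letter0 addr0.
- rewrite cons_letter0 add0r -cons_letterU -[_ *: wordv w]addr0.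
  by rewrite cons_letterP cons_letter0 addr0.
Qed.

Lemma mcoeff_nonempty z : nonempty z -> mcoeff [::] z = 0.
Proof.
move=> /asboolP[c cP ->]; rewrite -[lin_ext _ c]/(lin_ext (fun w => wordv w) c).
rewrite lin_ext_mkmalgU; apply/mcoeff_outdom/negP => /cP.
by rewrite eqxx.
Qed.

Lemma nonempty_sub z : nonempty (z - mcoeff [::] z *: wordv [::]).
Proof.
apply/asboolP; exists (z - mcoeff [::] z *: wordv [::]).
  move=> w; apply: contraTneq => ->.
  by rewrite -mcoeff_eq0 mcoeffB mcoeffZ mcoeffUU mulr1 subrr.
by rewrite lin_ext_mkmalgU.
Qed.

Lemma shuffle_words_augmented : is_augmented_dendriform (shuffle_words K).
Proof.
have nonemptyD x y : nonempty x -> nonempty y -> nonempty (x + y).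
  exact: rpredD.
split=> /=.
- split=> /=.
  + split; first exact: rpred0.
    by move=> k x y Px Py; apply: rpredD => //; apply: rpredZ.
  + move=> _ z /nonemptyP[x [y ->]] _; rewrite bilin_extDl !prec_cons.
    by apply: nonemptyD; apply: cons_letter_nonempty.
  + move=> z _ _ /nonemptyP[x [y ->]]; rewrite bilin_extDr !succ_cons.
    by apply: nonemptyD; apply: cons_letter_nonempty.
  + exact: bilin_ext_bilinear.
  + exact: bilin_ext_bilinear.
  + move=> x y z /nonemptyP Px /nonemptyP Py _.
    exact: (half_prec_prec (bilin_extDl _) (bilin_extDl _) (bilin_extDl _)
      prec_cons cons_letter_star starA _ Px Py).
  + move=> x y z _ /nonemptyP Py _.
    exact: (half_succ_prec (bilin_extDl _) (bilin_extDr _) prec_cons succ_cons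
      starA _ _ Py).
  + move=> x y z /nonemptyP Px _ /nonemptyP Pz.
    exact: (half_star_succ (bilin_extDl _) (bilin_extDl _) (bilin_extDl _)
      (bilin_extDr _) succ_cons cons_letter_star starA _ Px Pz).
(* The coefficient of the empty word is the projection onto the unit line; it vanishes on the
   augmentation part, whence uniqueness. *)
- move=> z; exists (mcoeff [::] z, z - mcoeff [::] z *: wordv [::]).
  split=> /=.
    by split; [exact: nonempty_sub | rewrite subrK].
  move=> [k x] /= [xP ->].
  by rewrite mcoeffD mcoeffZ mcoeffUU mulr1 mcoeff_nonempty// add0r addrK.
- by move=> x _; exact: prec_1l.
- by move=> x _; exact: succ_1r.
- move=> _ /nonemptyP[x [y ->]].
  by rewrite bilin_extDl !prec_cons !star_1r.
- move=> _ /nonemptyP[x [y ->]].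
  by rewrite bilin_extDr !succ_cons !star_1l.
- move=> x z /nonemptyP Px _.
  exact: (part_star (bilin_extDl _) (bilin_extDl _) (bilin_extDl _)
    cons_letter_star _ Px).
- exact: star_1l.
- exact: star_1r.
- exact: bilin_ext_bilinear.
Qed.

End ShuffleAlgebra.

(** * Transport to chain integrals *)

(** Every element of [E] is rewritten as [f (g a)]; compatibility of [f] with the operations then
    turns each axiom of [E] into the image under [f] of the same axiom of [D]. *)
Lemma augmented_dendriform_transport (K : fieldType) (D E : aug_data K)
    (f : {linear D -> E}) (g : E -> D) :
  cancel f g -> cancel g f -> f (aug_one D) = aug_one E ->
  (forall a, aug_part (f a) = aug_part a) ->
  {morph f : a b / aug_prec a b >-> aug_prec a b} ->
  {morph f : a b / aug_succ a b >-> aug_succ a b} ->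
  {morph f : a b / aug_star a b >-> aug_star a b} ->
  is_augmented_dendriform D -> is_augmented_dendriform E.
Proof.
move=> fK gK f1 fP fprec fsucc fstar [[D0 Dpc Dsc Dpb Dsb Dpp Dsp Dss]].
move=> Dd D1p Ds1 Dp1 D1s Dst D1t Dt1 Dtb.
have fbil P op Q op' : (forall a, Q (f a) = P a) ->
    {morph f : a b / op a b >-> op' a b} ->
    bilinear_on P op -> bilinear_on Q op'.
  move=> PQ fop [bl br]; split=> k a b c;
    rewrite -[a]gK -[b]gK -[c]gK !PQ => Pa Pb Pc.
    by rewrite -linearP -!fop bl// linearP.
  by rewrite -linearP -!fop br// linearP.
split.
- split.
  + case: D0 => P0 PS; split.
      by rewrite -[0](raddf0 f) -[_ \in _]/(aug_part _) fP.
    move=> k a b; rewrite -[a]gK -[b]gK -linearP -![_ \in _]/(aug_part _) !fP.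
    exact: PS.
  + by move=> a b; rewrite -[a]gK -[b]gK -fprec !fP; exact: Dpc.
  + by move=> a b; rewrite -[a]gK -[b]gK -fsucc !fP; exact: Dsc.
  + exact: fbil Dpb.
  + exact: fbil Dsb.
  + move=> a b c; rewrite -[a]gK -[b]gK -[c]gK !fP => Pa Pb Pc.
    by rewrite -!fprec -fsucc -raddfD -fprec Dpp.
  + move=> a b c; rewrite -[a]gK -[b]gK -[c]gK !fP => Pa Pb Pc.
    by rewrite -!fprec -!fsucc -fprec Dsp.
  + move=> a b c; rewrite -[a]gK -[b]gK -[c]gK !fP => Pa Pb Pc.
    by rewrite -!fprec -!fsucc -raddfD -fsucc Dss.
- move=> z; have [[k x] [[/= xP zE] xU]] := Dd (g z).
  exists (k, f x); split=> /=.
    by rewrite fP -f1; split=> //; rewrite addrC -linearP addrC -zE gK.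
  move=> [l y] /= [yP zE'].
  (* Uniqueness in [D] is applied to the pullback [(l, g y)] of the competing decomposition. *)
  have [-> ->] : (k, x) = (l, g y); last by rewrite gK.
  apply: xU; split=> /=; first by rewrite -fP gK.
  by rewrite zE' -f1 -{1}[y]gK addrC -linearP addrC fK.
- by move=> a; rewrite -[a]gK fP -f1 => Pa; rewrite -fprec D1p//; exact: raddf0.
- by move=> a; rewrite -[a]gK fP -f1 => Pa; rewrite -fsucc Ds1//; exact: raddf0.
- by move=> a; rewrite -[a]gK fP -f1 => Pa; rewrite -fprec Dp1//.
- by move=> a; rewrite -[a]gK fP -f1 => Pa; rewrite -fsucc D1s//.
- move=> a b; rewrite -[a]gK -[b]gK !fP => Pa Pb.
  by rewrite -fstar -fprec -fsucc -raddfD Dst.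
- by move=> a; rewrite -[a]gK -f1 -fstar D1t.
- by move=> a; rewrite -[a]gK -f1 -fstar Dt1.
- exact: fbil Dtb.
Qed.

(** * Shuffle products as sums over shuffle permutations *)

Section ShuffleSums.
Variables (K : fieldType) (V : lmodType K).

Lemma lin_ext_cons (f : word -> V) a c :
  lin_ext f (cons_letter a c) = lin_ext (fun w => f (a :: w)) c.
Proof.
rewrite linear_lin_ext; apply: eq_lin_ext => w; exact: lin_extU.
Qed.

Lemma sum_first_left n (f : word -> V) a u v : n = (size u + size v)%N ->
  (\sum_(s in shuffles (size u).+1 n.+1 | first_from 0 s)
    f (permute (a :: u ++ v) s)) =
  \sum_(s in shuffles (size u) n) f (a :: permute (u ++ v) s).
Proof.
move=> nuv; rewrite (@sum_first_from _ _ _ _ ord0)//; last by right.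
rewrite subn1 /=; apply: eq_bigr => s _.
by rewrite permute_lift//= drop0.
Qed.

Lemma sum_first_right n (f : word -> V) u b v : n = (size u + size v)%N ->
  (\sum_(s in shuffles (size u) n.+1 | first_from (size u) s)
    f (permute (u ++ b :: v) s)) =
  \sum_(s in shuffles (size u) n) f (b :: permute (u ++ v) s).
Proof.
move=> nuv; have un : (size u < n.+1)%N by lia.
rewrite (@sum_first_from _ _ _ _ (Ordinal un))//; last by left.
rewrite ltnn subn0 /=; apply: eq_bigr => s _.
rewrite permute_lift/= ?size_cat/= ?addnS ?nuv ?ltnS ?leq_addr//.
rewrite nth_cat ltnn subnn take_size_cat//= drop_cat ltnNge leqnSn.
by rewrite subSn// subnn /= drop0.
Qed.

(** Induction on the total length: splitting the permutations by the origin of the first letter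
    reproduces the recursion of [word_star]. The function [f] is arbitrary because removing a
    leading letter [a] replaces it by [fun w => f (a :: w)]. *)
Lemma lin_ext_word_star n (f : word -> V) u v : n = (size u + size v)%N ->
  lin_ext f (word_star K u v) =
  \sum_(s in shuffles (size u) n) f (permute (u ++ v) s).
Proof.
elim: n f u v => [|n IHn] f u v.
  case: u => [|//]; case: v => [|//] _.
  rewrite lin_extU (big_pred1 1%g) => [|s].
    by rewrite /permute (size0nil (s := enum 'I_0))// -cardE card_ord.
  have -> : s = 1%g by apply/permP => -[].
  by rewrite [RHS]eqxx; apply/shufflesP => -[].
move=> nuv; rewrite sum_shuffles_first.
case: u nuv => [|a u] nuv.
  case: v nuv => [//|b v] [nv]; rewrite add0r /=.
  rewrite (@sum_first_right _ _ [::])// -(IHn (fun w => f (b :: w)) [::])//.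
  by rewrite word_nil_star !lin_extU.
rewrite (@sum_first_left _ _ _ u v); last by case: nuv.
rewrite -(IHn (fun w => f (a :: w)) u v); last by case: nuv.
case: v nuv => [|b v] nuv.
  (* With [v] empty, the first block has [n.+1] elements, so the guard of the second sum fails. *)
  rewrite /= word_star_nil !lin_extU ifF ?addr0//; rewrite -ltnS.
  by move: nuv => /=; lia.
rewrite (@sum_first_right _ _ (a :: u)); last by move: nuv => /=; lia.
rewrite -(IHn (fun w => f (b :: w)) (a :: u) v); last by move: nuv => /=; lia.
rewrite ifT; last by move: nuv => /=; lia.
by rewrite -!lin_ext_cons -raddfD.
Qed.

End ShuffleSums.

Section ChainProducts.
Variables (R : realType) (K : fieldType).
Let chain := @chainA R K.

Lemma lin_ext_word_prec u v :
  lin_ext chain (word_prec K u v) = chain_prec R K u v.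
Proof.
case: u v => [|a u] [|b v]; rewrite /= ?raddf0 ?lin_extU//.
rewrite lin_ext_cons (lin_ext_word_star _ (erefl _)).
exact/esym/(sum_first_left chain a (erefl (size u + size (b :: v))%N)).
Qed.

Lemma lin_ext_word_succ u v :
  lin_ext chain (word_succ K u v) = chain_succ R K u v.
Proof.
case: u v => [|a u] [|b v]; rewrite /= ?raddf0 ?lin_extU//.
(* Removing [b] leaves [size (a :: u) + size v] letters, whereas the permutations in [chain_succ]
   have degree convertible to the successor of [size u + (size v).+1]; [e] reconciles the two. *)
have e : (size u + (size v).+1)%N = (size (a :: u) + size v)%N.
  by rewrite /= addnS.
rewrite lin_ext_cons (lin_ext_word_star _ e).
exact/esym/(@sum_first_right _ _ _ chain (a :: u) b v e).
Qed.

Lemma lin_ext_chain_star u v :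
  lin_ext chain (word_star K u v) = chain_star R K u v.
Proof.
case: u v => [|a u] [|b v]; try by rewrite /= ?lin_extU.
by rewrite -[RHS]/(_ + _) -lin_ext_word_prec -lin_ext_word_succ -raddfD.
Qed.
End ChainProducts.

(** * Bijectivity and multiplicativity of [zeta_FI] *)

Section ZetaFI.
Variables (R : realType) (K : fieldType).
Let zeta : shuffle_words K -> chain_integrals R K := zeta_FI R K.

Lemma zeta_FI_surj z : zeta (chain_coords z) = z.
Proof. by rewrite /chain_coords; case: cid => c /= /esym. Qed.

(** By linear independence of the chain integrals, any coordinates of [zeta c] are those of [c], so
    both spans put the same condition on the support. *)
Lemma zeta_FI_part c : aug_part (zeta c) = aug_part c.
Proof.
apply/asboolP/asboolP => -[d dP e]; exists d => //.
  by rewrite lin_ext_mkmalgU; exact: chainA_free e.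
by move: e; rewrite lin_ext_mkmalgU => ->.
Qed.

(** [chain_bilin] works on coordinates, and the coordinates of [zeta c] are [c] itself, so agreement
    on pairs of words suffices. *)
Lemma zeta_FI_bilin f g :
  (forall u v, lin_ext (@chainA R K) (f u v) = g u v) ->
  {morph zeta : c d / bilin_ext f c d >-> chain_bilin g c d}.
Proof.
move=> fg c d; rewrite /chain_bilin !chain_coordsK.
rewrite -[LHS]/(lin_ext _ _) linear_bilin_ext.
exact: eq_bilin_ext.
Qed.

End ZetaFI.

Theorem proposition5p10 (R : realType) (K : fieldType) :
  is_augmented_morphism (zeta_FI R K).
Proof.
have zprec := zeta_FI_bilin (@lin_ext_word_prec R K).
have zsucc := zeta_FI_bilin (@lin_ext_word_succ R K).
have zstar := zeta_FI_bilin (@lin_ext_chain_star R K).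
have zone : zeta_FI R K (aug_one _) = aug_one (chain_integrals R K).
  exact: zeta_FIE.
split.
- exact: shuffle_words_augmented.
- apply: (@augmented_dendriform_transport _ _ _ (zeta_FI R K)
    (@chain_coords R K) (@chain_coordsK R K) (@zeta_FI_surj R K) zone
    (@zeta_FI_part R K) zprec zsucc zstar).
  exact: shuffle_words_augmented.
- exact: zone.
- by move=> c; rewrite zeta_FI_part.
- by move=> c d _ _; exact: zprec.
- by move=> c d _ _; exact: zsucc.
Qed.
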